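(* Let $\mathbf{X}=(X_i)_{i\in\mathbb{N}}$ and $Z$, with values in $E=\{1,\ldots,K\}$, satisfy the mixture model assumption stated in the context. Let $p\in\mathbb{N}$, let $\check{\boldsymbol\mu}_{1:p}(z)\in\mathbb{R}^p$ for $z\in E$ be fixed vectors, and let $$\hat Z=\arg\min_{z\in E}\|\mathbf{X}_{1:p}-\check{\boldsymbol\mu}_{1:p}(z)\|_2.$$ Suppose that $R^{(p)}_{z,v}\leq\frac1{10}$ for all $z,v\in E$ with $v\neq z$. Then $$\mathbb{P}(\hat Z\neq Z)\leq\frac{25K\sigma_{\max}^2}{\mathrm{sep}(p)}.$$ If, in addition, the conditional distribution of $X_i$ given $Z=z$ is sub-Gaussian with variance factor $v_{\max}$, independent of $i$ and $z$, then $$\mathbb{P}(\hat Z\neq Z)\leq K\exp\left(-\frac{\mathrm{sep}(p)}{50\,v_{\max}}\right).$$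
   Context: Mixture model assumption: $Z$ takes values in the finite set $E=\{1,\ldots,K\}$, the real valued variables $X_1,X_2,\ldots$ are conditionally independent given $Z=z$ for each $z \in E$, and (1) the conditional distribution of $X_i$ given $Z=z$ has finite second moment, with conditional mean $\mu_i(z)=\mathbb{E}[X_i\mid Z=z]$ and conditional variance $\sigma_i^2(z)=\mathrm{Var}[X_i\mid Z=z]$, for all $z\in E$, $i\in\mathbb{N}$; (2) $\sum_{i=1}^\infty(\mu_i(z)-\mu_i(v))^2=\infty$ for all $z,v\in E$ with $v\neq z$; (3) there are constants $0<\sigma_{\min}^2\leq\sigma_{\max}^2<\infty$ with $\sigma_{\min}^2\leq\max_{z\in E}\sigma_i^2(z)\leq\sigma_{\max}^2$ for all $i\in\mathbb{N}$; (4) $\mathbb{P}(Z=z)>0$ for all $z\in E$. Notation: $\mathbf{X}_{1:p}=(X_1,\ldots,X_p)$, $\boldsymbol\mu_{1:p}(z)=(\mu_i(z))_{i=1,\ldots,p}\in\mathbb{R}^p$. The relative errors are $$R^{(p)}_{z,v}=\frac{\|\boldsymbol\mu_{1:p}(z)-\check{\boldsymbol\mu}_{1:p}(z)\|_2}{\|\boldsymbol\mu_{1:p}(z)-\boldsymbol\mu_{1:p}(v)\|_2},\qquad v\neq z$$ (the assumption on them presupposes that the denominators are nonzero), and the minimal $p$-separation is $\mathrm{sep}(p)=\min_{z\neq v}\|\boldsymbol\mu_{1:p}(z)-\boldsymbol\mu_{1:p}(v)\|_2^2$ (which presupposes $K\geq2$). Ties in the argmin are broken by any fixed measurable rule. ''$X_i$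 given $Z=z$ is sub-Gaussian with variance factor $v_{\max}$'' means $\log\mathbb{E}\big[e^{\lambda(X_i-\mu_i(z))}\mid Z=z\big]\leq\frac12\lambda^2v_{\max}$ for all $\lambda\in\mathbb{R}$. *)

(* Defs.v *)
From mathcomp Require Import all_boot all_order all_algebra finmap.
From mathcomp Require Import all_classical all_reals all_analysis.

Set Implicit Arguments.
Unset Strict Implicit.
Unset Printing Implicit Defensive.

Import Order.TTheory GRing.Theory Num.Theory.
Import numFieldNormedType.Exports.

Local Open Scope classical_set_scope.
Local Open Scope ring_scope.

(* The library norm on 'rV[R]_p is the sup norm, hence this definition. *)
Definition norm2 (R : realType) (p : nat) (x : 'rV[R]_p) : R :=
  Num.sqrt (\sum_(i < p) x 0 i ^+ 2).

Section mixture.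
Context {d : measure_display} {T : measurableType d} {R : realType}.
Variable P : probability T R.

(* U |-> P (U `&` A) / P A, as a probability measure. If P A = 0 then
   mnormalize falls back on P itself. *)
Definition cond_prob (A : set T) (mA : measurable A) : probability T R :=
  mnormalize (mrestr P mA) P.

Definition mutually_independent (X : nat -> T -> R) : Prop :=
  forall (J : {fset nat}) (B : nat -> set R),
    (forall i, measurable (B i)) ->
    P (\bigcap_(i in [set` J]) (X i @^-1` B i)) =
    (\prod_(i <- J) P (X i @^-1` B i))%E.

End mixture.

Section model.
Context {d : measure_display} {T : measurableType d} {R : realType}.
Variables (P : probability T R) (K : nat) (Z : T -> 'I_K).
(* The label set {1, ..., K} is 'I_K. For K arbitrary it is not a
   measurableType (which must be pointed), so the measurability of Z for the
   discrete sigma-algebra is stated on singletons. *)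
Hypothesis mZ : forall z, measurable (Z @^-1` [set z]).
Variable X : nat -> {RV P >-> R}.

Definition given (z : 'I_K) : probability T R := cond_prob P (mZ z).

Definition cond_mean (i : nat) (z : 'I_K) : R := fine 'E_(given z)[X i].

Definition cond_var (i : nat) (z : 'I_K) : \bar R := 'V_(given z)[X i].

Record mixture_model (sigma2_min sigma2_max : R) : Prop := MixtureModel {
  mixture_cond_independent : forall z,
    mutually_independent (given z) X ;
  mixture_second_moment : forall z i,
    (X i : T -> R) \in Lfun (given z) 2%:E ;
  mixture_separated : forall z v, v != z ->
    (\sum_(0 <= i <oo) ((cond_mean i z - cond_mean i v) ^+ 2)%:E = +oo)%E ;
  mixture_var_bounds : 0 < sigma2_min <= sigma2_max ;
  mixture_max_var : forall i,
    (sigma2_min%:E <= \big[maxe/-oo]_(z < K) cond_var i z <= sigma2_max%:E)%E ;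
  mixture_label_pos : forall z, (0 < P (Z @^-1` [set z]))%E }.

(* Coordinate i : 'I_p of R^p corresponds to X i, i.e. the variables
   X_1, ..., X_p are X 0, ..., X p.-1. *)
Definition obs (p : nat) (w : T) : 'rV[R]_p := \row_(i < p) X i w.

Definition mean_vec (p : nat) (z : 'I_K) : 'rV[R]_p :=
  \row_(i < p) cond_mean i z.

Definition mean_dist (p : nat) (z v : 'I_K) : R :=
  norm2 (mean_vec p z - mean_vec p v).

Definition relative_error (p : nat) (muc : 'I_K -> 'rV[R]_p) (z v : 'I_K) : R :=
  norm2 (mean_vec p z - muc z) / mean_dist p z v.

(* A minimum as soon as 2 <= K: the set is then finite and nonempty. *)
Definition sep (p : nat) : R :=
  inf [set mean_dist p zv.1 zv.2 ^+ 2
      | zv in [set zv : 'I_K * 'I_K | zv.1 != zv.2]].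

(* Z' is an argmin of the distances to the centers, with arbitrary
   (measurable) tie-breaking. *)
Record nearest_center (p : nat) (muc : 'I_K -> 'rV[R]_p) (Z' : T -> 'I_K)
    : Prop := NearestCenter {
  nearest_center_measurable : forall z, measurable (Z' @^-1` [set z]) ;
  nearest_center_argmin : forall w z,
    norm2 (obs p w - muc (Z' w)) <= norm2 (obs p w - muc z) }.

(* 'M_(given z) is the moment generating function; lne is the logarithm on
   \bar R, with lne +oo = +oo. *)
Definition cond_sub_gaussian (vmax : R) : Prop :=
  forall (i : nat) (z : 'I_K) (lambda : R),
    (lne ('M_(given z) (X i \- cst (cond_mean i z))%R lambda)
      <= (2^-1 * lambda ^+ 2 * vmax)%R%:E)%E.

End model.

(* Main.v *)
From HB Require Import structures.
Require Import Defs.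
From mathcomp Require Import all_boot all_order all_algebra finmap.
From mathcomp Require Import all_classical all_reals all_analysis.
From mathcomp Require Import measurable_realfun ring lra.
Import Order.TTheory GRing.Theory Num.Theory.
Import numFieldNormedType.Exports.
Local Open Scope classical_set_scope.
Local Open Scope ring_scope.

(** Condition on the true label z and suppose that another label v is chosen.
    Write m, n for the true means of z and v, a, b for their estimates,
    D = |m - n| and h = b - a.  The observation x is then at least as close to
    b as to a, so it lies beyond the bisecting hyperplane of a and b.  Because
    a and b are within D / 10 of m and n, the hyperplane is still far from m,
    namely [<h, x - m> >= (D / 5) |h|] ([nearest_center_dot]); the constant 3/10
    would do as well, but 1/5 is what the claimed bounds need.

    What remains is the tail of [<h, x - m>], a linear combination of centred
    variables that are independent given z.  Its variance is at most
    [sigma2_max |h|^2], and Chebyshev gives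
    [25 sigma2_max / D^2] ([chebyshev_confusion]).  In the sub-Gaussian case its
    moment generating function at r is at most [exp (r^2 vmax |h|^2 / 2)], and
    Chernoff with the optimal r gives [exp (- D^2 / (50 vmax))]
    ([chernoff_confusion]).  Since D^2 is at least the separation, a union bound
    over v, which costs the factor K, and the law of total probability over z
    conclude ([misclassification_le]).

    Independence is given as a product rule for events.  Both tail bounds need it
    for expectations: [ge0_integral_prod] is the product rule for nonnegative
    functions of the variables, and splitting into positive and negative parts
    turns it into [covariance_independent]. *)

(** * The product rule for expectations of independent variables *)

Section IndependenceIntegral.
Context {d : measure_display} {T : measurableType d} {R : realType}.
Variable Q : probability T R.
Local Open Scope ereal_scope.

Import HBNNSimple.

Lemma cvg_monotone_integral (D : set T) (g : nat -> T -> R) (f : T -> R) :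
    measurable D -> (forall n, measurable_fun [set: T] (g n)) ->
    (forall n w, (0 <= g n w)%R) ->
    (forall w, nondecreasing_seq (g ^~ w)) ->
    (forall w, (g n w)%:E @[n --> \oo] --> (f w)%:E) ->
  \int[Q]_(w in D) (g n w)%:E @[n --> \oo] --> \int[Q]_(w in D) (f w)%:E.
Proof.
move=> mD mg g0 ndg gf.
rewrite (eq_integral (fun w => limn (fun n => (g n w)%:E))); last first.
  by move=> w _; exact/esym/cvg_lim.
apply: (@cvg_monotone_convergence _ _ _ Q D mD (fun n w => (g n w)%:E)).
- by move=> n; apply/measurable_EFinP; exact: measurable_funTS.
- by move=> n w _; rewrite lee_fin.
- by move=> w _ a b ab; rewrite lee_fin; exact: ndg.
Qed.

(** A simple function is a finite combination of indicators of its fibres, so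
    the factorization on events extends to it by linearity. *)
Lemma ge0_integral_sfun_factor (D : set T) (Y : T -> R) (X : {RV Q >-> R})
    (c : \bar R) (h : {nnsfun R >-> R}) :
    measurable D -> measurable_fun [set: T] Y -> (forall w, (0 <= Y w)%R) ->
    0 <= c ->
    (forall B : set R, measurable B ->
      \int[Q]_(w in D `&` X @^-1` B) (Y w)%:E = c * Q (X @^-1` B)) ->
  \int[Q]_(w in D) (Y w * h (X w))%:E =
  c * \sum_(y <- fset_set (range h)) y%:E * Q (X @^-1` (h @^-1` [set y])).
Proof.
move=> mD mY Y0 c0 YX.
have hE w : h (X w) =
   (\sum_(y <- fset_set (range h)) y * \1_(h @^-1` [set y]) (X w))%R.
  by rewrite {1}(fimfunE h) fsbig_finite.
have mI y : measurable (X @^-1` (h @^-1` [set y])).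
  by rewrite -[X in measurable X]setTI; apply: measurable_funP => //;
     exact: measurable_sfunP.
have y_ge0 y : y \in fset_set (range h) -> (0 <= y)%R.
  by rewrite in_fset_set// inE => -[x _ <-].
have int1 y : y \in fset_set (range h) ->
    \int[Q]_(w in D) (Y w * (y * \1_(h @^-1` [set y]) (X w)))%:E =
    y%:E * \int[Q]_(w in D `&` X @^-1` (h @^-1` [set y])) (Y w)%:E.
  move=> hy; rewrite integral_mkcondr -ge0_integralZl_EFin//.
  - apply: eq_integral => w _; rewrite epatch_indic /= mulrCA.
    by rewrite EFinM EFinM.
  - by move=> w _; apply: erestrict_ge0 => x _; rewrite lee_fin.
  - apply/(measurable_restrict _ (mI y) mD); apply/measurable_EFinP.
    exact: measurable_funTS.
  - exact: y_ge0.
under eq_integral do rewrite hE mulr_sumr -sumEFin.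
rewrite ge0_integral_sum//; last 2 first.
  - move=> y; apply/measurable_EFinP; apply: measurable_funM => //.
      exact: measurable_funTS.
    apply: measurable_funM => //.
    rewrite (_ : (fun w => _) = \1_(X @^-1` (h @^-1` [set y])))//.
  - move=> y w _; rewrite EFinM mule_ge0 ?lee_fin//.
    by rewrite -lee_fin; exact: nnfun_muleindic_ge0.
rewrite big_seq [in RHS]big_seq ge0_sume_distrr; last first.
  by move=> y hy; rewrite mule_ge0// lee_fin y_ge0.
apply: eq_bigr => y hy.
by rewrite int1// YX 1?muleCA//; exact: measurable_sfunP.
Qed.

(** If Y factors from every event of X, then it factors from every nonnegative
    function of X.  The constant [c] is the expectation of Y on [D], but keeping
    it abstract lets it be supplied as a product of expectations; it may be
    infinite, hence the case split on zeros before passing to the limit. *)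
Lemma ge0_integral_comp_factor (D : set T) (Y : T -> R) (X : {RV Q >-> R})
    (c : \bar R) :
    measurable D -> measurable_fun [set: T] Y -> (forall w, (0 <= Y w)%R) ->
    0 <= c ->
    (forall B : set R, measurable B ->
      \int[Q]_(w in D `&` X @^-1` B) (Y w)%:E = c * Q (X @^-1` B)) ->
  forall f : R -> R, measurable_fun [set: R] f -> (forall x, (0 <= f x)%R) ->
  \int[Q]_(w in D) (Y w * f (X w))%:E = c * \int[Q]_w (f (X w))%:E.
Proof.
move=> mD mY Y0 c0 YX f mf f0.
have mEf : measurable_fun [set: R] (fun x => (f x)%:E) by exact/measurable_EFinP.
pose h := nnsfun_approx measurableT mEf.
have mX : measurable_fun [set: T] X by exact: measurable_funP.
have mhX n : measurable_fun [set: T] (h n \o X) by exact: measurableT_comp.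
have h_ge0 n x : (0 <= h n x)%R by [].
have hcvg x : (h n x)%:E @[n --> \oo] --> (f x)%:E.
  by apply: (@cvg_nnsfun_approx _ _ _ _ measurableT _ mEf) => // y _; rewrite lee_fin.
have hnd x a b : (a <= b)%N -> (h a x <= h b x)%R.
  by move=> ab; exact/lefP/nd_nnsfun_approx.
(* both sides are the same finite sum; the right one is the case Y = 1 *)
have simple n : \int[Q]_(w in D) (Y w * h n (X w))%:E =
    c * \int[Q]_w (h n (X w))%:E.
  rewrite (@ge0_integral_sfun_factor D Y X c (h n))//.
  have := @ge0_integral_sfun_factor setT (cst 1%R) X 1 (h n).
  rewrite mul1e => <- //; last first.
    move=> B mB; rewrite setTI; rewrite -(integral_cst Q _ 1)//.
    by rewrite -[X in measurable X]setTI; exact: mX.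
  by congr (c * _); apply: eq_integral => w _; rewrite mul1r.
have cvgl : \int[Q]_(w in D) (Y w * h n (X w))%:E @[n --> \oo] -->
    \int[Q]_(w in D) (Y w * f (X w))%:E.
  apply: cvg_monotone_integral => //.
  - by move=> n; apply: measurable_funM => //; exact: mhX.
  - by move=> n w; rewrite mulr_ge0.
  - by move=> w a b ab; rewrite ler_wpM2l ?hnd.
  - move=> w; under eq_fun do rewrite EFinM.
    by rewrite EFinM; apply: cvgeZl.
have cvgr : \int[Q]_w (h n (X w))%:E @[n --> \oo] -->
    \int[Q]_w (f (X w))%:E.
  by apply: cvg_monotone_integral => // w a b; exact: hnd.
apply: (cvg_unique _ cvgl) => //.
rewrite (_ : (fun n => _) = fun n => c * \int[Q]_w (h n (X w))%:E); last first.
  exact/funext.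
have [->|c_neq0] := eqVneq c 0.
  rewrite mul0e (_ : (fun n => _) = cst 0); first exact: cvg_cst.
  by apply/funext => n; rewrite mul0e.
have [intf0|intf0] := eqVneq (\int[Q]_w (f (X w))%:E) 0.
  rewrite (_ : (fun _ => _) = cst (c * \int[Q]_w (f (X w))%:E)); last first.
    apply/funext => n /=; congr (_ * _); apply/eqP; rewrite eq_le intf0.
    rewrite [X in _ && X]integral_ge0 ?andbT; last by move=> w _; rewrite lee_fin.
    rewrite -intf0; apply: ge0_le_integral => //.
    - by move=> w _; rewrite lee_fin.
    - exact/measurable_EFinP/mhX.
    - by apply/measurable_EFinP; exact: measurableT_comp.
    - move=> w _; rewrite lee_fin.
      have hf : h k (X w) @[k --> \oo] --> f (X w).
        exact: fine_cvg (hcvg (X w)).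
      rewrite -(cvg_lim _ hf)//; apply: nondecreasing_cvgn_le.
        by move=> a b; exact: hnd.
      by apply/cvg_ex; exists (f (X w)).
  exact: cvg_cst.
apply: cvgeM => //; last exact: cvg_cst.
by rewrite mule_defE (negPf c_neq0) (negPf intf0).
Qed.

(** Interpolates between the product rule for events ([s1] empty) and the one for
    functions ([s2] empty).  Each step of the induction moves one index from
    events to functions by [ge0_integral_comp_factor], whose hypothesis on events
    is the induction hypothesis with that index put back into [s2]. *)
Lemma ge0_integral_prod_events (X : nat -> {RV Q >-> R}) (s1 s2 : seq nat)
    (f : nat -> R -> R) (B : nat -> set R) :
    mutually_independent Q (fun i => X i : T -> R) -> uniq (s1 ++ s2) ->
    (forall i, measurable_fun [set: R] (f i)) ->
    (forall i x, (0 <= f i x)%R) ->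
    (forall i, measurable (B i)) ->
  \int[Q]_(w in \bigcap_(i in [set` s2]) X i @^-1` B i)
     (\prod_(i <- s1) f i (X i w))%:E =
  (\prod_(i <- s1) \int[Q]_w (f i (X i w))%:E) *
  \prod_(i <- s2) Q (X i @^-1` B i).
Proof.
move=> indX + mf f0; elim: s1 s2 B => [|j s1 IH] s2 B us mB.
  have mI : measurable (\bigcap_(i in [set` s2]) X i @^-1` B i).
    by apply: fin_bigcap_measurable => // i _;
       rewrite -[X in measurable X]setTI; exact: measurable_funP.
  under eq_integral do rewrite big_nil.
  rewrite big_nil mul1e (integral_cst Q mI 1) mul1e.
  have indE := indX [fset i in s2]%fset B mB.
  rewrite (_ : [set` s2] = [set` [fset i in s2]%fset]); last first.
    by apply/seteqP; split => i /=; rewrite inE.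
  apply: (etrans indE); apply: perm_big; apply: uniq_perm => //.
  by move=> i; rewrite inE.
under eq_integral do rewrite big_cons mulrC.
rewrite (@ge0_integral_comp_factor _ _ (X j) (
   (\prod_(i <- s1) \int[Q]_w (f i (X i w))%:E) *
   \prod_(i <- s2) Q (X i @^-1` B i))) //.
- by rewrite big_cons muleC muleA.
- by apply: fin_bigcap_measurable => // i _;
     rewrite -[X in measurable X]setTI; exact: measurable_funP.
- apply: measurable_prod => i _; apply: measurableT_comp => //.
- by move=> w; rewrite prodr_ge0.
- rewrite mule_ge0// prode_ge0// => i _.
  by apply: integral_ge0 => w _; rewrite lee_fin.
move=> C mC.
pose B' i := if i == j then C else B i.
have us2 : j \notin s2.
  by move: us => /= /andP[]; rewrite mem_cat negb_or => /andP[].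
have B's2 i : i \in s2 -> B' i = B i.
  by rewrite /B'; case: eqP => // ->; rewrite (negPf us2).
have B'X : \bigcap_(i in [set` s2]) X i @^-1` B i `&` X j @^-1` C =
    \bigcap_(i in [set` j :: s2]) X i @^-1` B' i.
  apply/seteqP; split => w /=.
    move=> [s2w jw] i /=; rewrite inE => /orP[/eqP ->|s2i].
      by rewrite /B' eqxx.
    by rewrite B's2//; exact: s2w.
  move=> s2w; split.
    by move=> i /= s2i; rewrite -B's2//; apply: s2w; rewrite /= inE s2i orbT.
  by have := s2w j; rewrite /B' eqxx; apply; rewrite /= inE eqxx.
(* the index j is listed once, so its event can be prescribed freely *)
rewrite B'X IH.
- rewrite big_cons (_ : B' j = C); last by rewrite /B' eqxx.
  rewrite [X in _ * X]muleC muleA; congr (_ * _ * _).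
  by rewrite big_seq [in RHS]big_seq; apply: eq_bigr => i /B's2 ->.
- by rewrite -cat1s uniq_catCA.
- by move=> i; rewrite /B'; case: ifP.
Qed.

Lemma ge0_integral_prod (X : nat -> {RV Q >-> R}) (s : seq nat)
    (f : nat -> R -> R) :
    mutually_independent Q (fun i => X i : T -> R) -> uniq s ->
    (forall i, measurable_fun [set: R] (f i)) ->
    (forall i x, (0 <= f i x)%R) ->
  \int[Q]_w (\prod_(i <- s) f i (X i w))%:E =
  \prod_(i <- s) \int[Q]_w (f i (X i w))%:E.
Proof.
move=> indX us mf f0.
have := @ge0_integral_prod_events X s [::] f (fun=> setT) indX.
rewrite cats0 set_nil bigcap_set0 big_nil mule1; apply => //.
Qed.

Lemma covariance_independent_ge0 (X : nat -> {RV Q >-> R}) (i j : nat)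
    (f g : R -> R) :
    mutually_independent Q (fun i => X i : T -> R) -> i != j ->
    measurable_fun [set: R] f -> measurable_fun [set: R] g ->
    (forall x, (0 <= f x)%R) -> (forall x, (0 <= g x)%R) ->
    (f \o X i : T -> R) \in Lfun Q 2%:E -> (g \o X j : T -> R) \in Lfun Q 2%:E ->
  covariance Q (f \o X i) (g \o X j) = 0.
Proof.
move=> indX ij mf mg f0 g0 f2 g2.
have Qfin : Q setT \is a fin_num by exact: fin_num_measure.
have f1 := Lfun_subset12 Qfin f2.
have g1 := Lfun_subset12 Qfin g2.
rewrite covarianceE//; last exact: Lfun2_mul_Lfun1.
have := @ge0_integral_prod X [:: i; j] (fun k => if k == i then f else g) indX.
rewrite !big_cons !big_nil eqxx eq_sym (negPf ij) mule1.
under eq_integral do rewrite !big_cons !big_nil eqxx eq_sym (negPf ij) mulr1.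
move=> fg; rewrite unlock fg ?subee//.
- rewrite fin_numM//; move: (expectation_fin_num f1) (expectation_fin_num g1);
    by rewrite unlock.
- by rewrite /= inE ij.
- by move=> k; case: ifP.
- by move=> k x; case: ifP.
Qed.

Lemma Lfun2_norm (X : T -> R) :
  X \in Lfun Q 2%:E -> (Num.norm \o X) \in Lfun Q 2%:E.
Proof.
move=> /[!inE] /andP[/[!inE]/= mX X2].
apply/andP; split; first by rewrite inE/=; exact: measurableT_comp.
move: X2; rewrite !inE/= /finite_norm.
by rewrite -[X in X < _ -> _]Lnorm_abse.
Qed.

(** The variables are not of constant sign, so the product rule is applied to
    the four products of positive and negative parts, and bilinearity of the
    covariance puts them together. *)
Lemma covariance_independent (X : nat -> {RV Q >-> R}) (i j : nat) :
    mutually_independent Q (fun i => X i : T -> R) -> i != j ->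
    (X i : T -> R) \in Lfun Q 2%:E -> (X j : T -> R) \in Lfun Q 2%:E ->
  covariance Q (X i) (X j) = 0.
Proof.
move=> indX ij i2 j2.
pose pos (x : R) : R := ((`|x| + x) / 2)%R.
pose neg (x : R) : R := ((`|x| - x) / 2)%R.
have mpos : measurable_fun [set: R] pos.
  by apply: measurable_funM => //; apply: measurable_funD => //; exact: normr_measurable.
have mneg : measurable_fun [set: R] neg.
  by apply: measurable_funM => //; apply: measurable_funB => //; exact: normr_measurable.
have pos0 x : (0 <= pos x)%R.
  by rewrite divr_ge0// -lerBlDr sub0r -normrN ler_norm.
have neg0 x : (0 <= neg x)%R.
  by rewrite divr_ge0// subr_ge0 ler_norm.
have posneg (Y : T -> R) : Y = ((pos \o Y) \- (neg \o Y))%R.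
  by apply/funext => w /=; rewrite /pos /neg -mulrBl; lra.
have pos2 (Y : T -> R) : Y \in Lfun Q 2%:E -> pos \o Y \in Lfun Q 2%:E.
  move=> Y2.
  rewrite (_ : _ \o _ = 2^-1 \o* ((Num.norm \o Y) \+ Y))%R //.
  apply: Lfun_scale; first by rewrite ler1n.
  by rewrite rpredD ?lee1n//= => _; exact: Lfun2_norm.
have neg2 (Y : T -> R) : Y \in Lfun Q 2%:E -> neg \o Y \in Lfun Q 2%:E.
  move=> Y2.
  rewrite (_ : _ \o _ = 2^-1 \o* ((Num.norm \o Y) \- Y))%R //.
  apply: Lfun_scale; first by rewrite ler1n.
  by rewrite rpredB ?lee1n//= => _; exact: Lfun2_norm.
have pi := pos2 _ i2. have ni := neg2 _ i2.
have pj := pos2 _ j2. have nj := neg2 _ j2.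
rewrite (posneg (X i)) (posneg (X j)).
rewrite covarianceBl//; last by rewrite rpredB ?lee1n.
rewrite !covarianceBr// !covariance_independent_ge0//.
by rewrite !sube0.
Qed.

(** * Variance of linear combinations *)

Let lincomb (X : nat -> {RV Q >-> R}) (s : seq nat) (a : nat -> R) : T -> R :=
  fun w => (\sum_(i <- s) a i * X i w)%R.

Let lincomb_cons X j s a :
  lincomb X (j :: s) a = ((a j \o* X j) \+ lincomb X s a)%R.
Proof. by apply/funext => w /=; rewrite /lincomb big_cons mulrC. Qed.

Lemma Lfun2_lincomb (X : nat -> {RV Q >-> R}) (s : seq nat) (a : nat -> R) :
    (forall i, (X i : T -> R) \in Lfun Q 2%:E) ->
  (fun w => (\sum_(i <- s) a i * X i w)%R) \in Lfun Q 2%:E.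
Proof.
move=> X2; rewrite -/(lincomb X s a); elim: s => [|j s IH].
  rewrite (_ : lincomb _ _ _ = cst 0%R) ?Lfun_cst//.
  by apply/funext => w; rewrite /lincomb big_nil.
by rewrite lincomb_cons rpredD ?lee1n//= => _; rewrite Lfun_scale ?ler1n.
Qed.

Lemma covariance_lincomb_independent (X : nat -> {RV Q >-> R}) (s : seq nat)
    (a : nat -> R) (j : nat) :
    mutually_independent Q (fun i => X i : T -> R) -> j \notin s ->
    (forall i, (X i : T -> R) \in Lfun Q 2%:E) ->
  covariance Q (fun w => (\sum_(i <- s) a i * X i w)%R) (X j) = 0.
Proof.
move=> indX + X2; rewrite -/(lincomb X s a).
have Qfin : Q setT \is a fin_num by exact: fin_num_measure.
elim: s => [_|k s IH].
  rewrite (_ : lincomb _ _ _ = cst 0%R) ?covariance_cst_l//.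
  by apply/funext => w; rewrite /lincomb big_nil.
rewrite inE negb_or => /andP[jk js].
rewrite lincomb_cons covarianceDl//; last 2 first.
- by rewrite Lfun_scale ?ler1n.
- exact: Lfun2_lincomb.
rewrite IH// adde0 covarianceZl; last 3 first.
- exact: (Lfun_subset12 Qfin).
- exact: (Lfun_subset12 Qfin).
- exact: Lfun2_mul_Lfun1.
by rewrite covariance_independent ?mule0// eq_sym.
Qed.

Lemma variance_lincomb_independent (X : nat -> {RV Q >-> R}) (s : seq nat)
    (a : nat -> R) :
    mutually_independent Q (fun i => X i : T -> R) -> uniq s ->
    (forall i, (X i : T -> R) \in Lfun Q 2%:E) ->
  'V_Q[fun w => (\sum_(i <- s) a i * X i w)%R] =
  \sum_(i <- s) (a i ^+ 2)%:E * 'V_Q[X i].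
Proof.
move=> indX + X2; rewrite -/(lincomb X s a).
have Qfin : Q setT \is a fin_num by exact: fin_num_measure.
elim: s => [_|j s IH /= /andP[js us]].
  rewrite (_ : lincomb _ _ _ = cst 0%R) ?variance_cst ?big_nil//.
  by apply/funext => w; rewrite /lincomb big_nil.
rewrite lincomb_cons varianceD//; last 2 first.
- by rewrite Lfun_scale ?ler1n.
- exact: Lfun2_lincomb.
rewrite big_cons IH// varianceZ// covarianceC covarianceZr; last 3 first.
- by apply: (Lfun_subset12 Qfin); exact: Lfun2_lincomb.
- exact: (Lfun_subset12 Qfin).
- by rewrite Lfun2_mul_Lfun1//; exact: Lfun2_lincomb.
by rewrite covariance_lincomb_independent// !mule0 adde0.
Qed.
End IndependenceIntegral.

(** * Euclidean geometry of the nearest-centre rule *)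

Section Euclidean.
Context {R : realType} {p : nat}.
Implicit Types x y : 'rV[R]_p.

Definition dot x y : R := \sum_(i < p) x 0 i * y 0 i.

Lemma sqr_norm2 x : norm2 x ^+ 2 = dot x x.
Proof.
rewrite /norm2 sqr_sqrtr; last by rewrite sumr_ge0// => i _; exact: sqr_ge0.
by apply: eq_bigr => i _; rewrite expr2.
Qed.

Lemma norm2_ge0 x : 0 <= norm2 x. Proof. exact: sqrtr_ge0. Qed.

Lemma dotC x y : dot x y = dot y x.
Proof. by apply: eq_bigr => i _; rewrite mulrC. Qed.

Lemma dotDl x y z : dot (x + y) z = dot x z + dot y z.
Proof. by rewrite -big_split; apply: eq_bigr => i _ /=; rewrite mxE mulrDl. Qed.

Lemma dotNl x y : dot (- x) y = - dot x y.
Proof. by rewrite -sumrN; apply: eq_bigr => i _; rewrite mxE mulNr. Qed.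

Lemma dotZl c x y : dot (c *: x) y = c * dot x y.
Proof. by rewrite mulr_sumr; apply: eq_bigr => i _; rewrite mxE mulrA. Qed.

Lemma dotDr x y z : dot z (x + y) = dot z x + dot z y.
Proof. by rewrite !(dotC z) dotDl. Qed.

Lemma dotNr x y : dot y (- x) = - dot y x.
Proof. by rewrite !(dotC y) dotNl. Qed.

Lemma norm2N x : norm2 (- x) = norm2 x.
Proof. by rewrite /norm2; congr Num.sqrt; apply: eq_bigr => i _; rewrite mxE sqrrN. Qed.

Lemma dot_le_norm2 x y : dot x y <= norm2 x * norm2 y.
Proof.
have [y0|y0] := eqVneq (norm2 y) 0.
  have yz i : y 0 i = 0.
    apply/eqP; rewrite -sqrf_eq0.
    move: (sqr_norm2 y); rewrite y0 expr0n /= => /esym/eqP.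
    rewrite psumr_eq0 => [/allP/(_ i)|j _]; last by rewrite -expr2 sqr_ge0.
    by rewrite mem_index_enum -expr2 => /(_ isT).
  by rewrite y0 mulr0 /dot big1// => i _; rewrite yz mulr0.
have y_gt0 : 0 < norm2 y by rewrite lt_def y0 norm2_ge0.
(* the vector |y|^2 x - <x,y> y has nonnegative square norm *)
have := sqr_ge0 (norm2 ((norm2 y ^+ 2) *: x - dot x y *: y)).
rewrite (sqr_norm2 (_ - _)) dotDl !dotDr !dotNl !dotNr !dotZl.
rewrite !(dotC _ (_ *: _)) !dotZl -!sqr_norm2 (dotC y x) => H.
rewrite leNgt; apply/negP => xy.
have : norm2 y ^+ 2 * ((norm2 x * norm2 y) ^+ 2 - dot x y ^+ 2) < 0.
  rewrite pmulr_rlt0 ?exprn_gt0// subr_lt0 ltr_sqr ?nnegrE//.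
  - by rewrite mulr_ge0 ?norm2_ge0.
  - by rewrite (le_trans _ (ltW xy))// mulr_ge0 ?norm2_ge0.
by nra.
Qed.

Lemma ler_norm2D x y : norm2 (x + y) <= norm2 x + norm2 y.
Proof.
rewrite -ler_sqr ?nnegrE ?addr_ge0 ?norm2_ge0//.
rewrite sqrrD !sqr_norm2 dotDl !dotDr (dotC y x).
have := dot_le_norm2 x y; lra.
Qed.

Lemma ler_norm2_detour (m n a b : 'rV[R]_p) :
  norm2 (m - n) <= norm2 (m - a) + norm2 (b - a) + norm2 (n - b).
Proof.
have -> : m - n = (m - a) + - (b - a) + - (n - b) by rewrite !opprB !subrKA.
rewrite -(norm2N (b - a)) -(norm2N (n - b)).
apply: le_trans (ler_norm2D _ _) _; rewrite lerD2r.
exact: ler_norm2D.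
Qed.

(** With [h = b - a] and [g = m - a], expanding [|x - b|^2 <= |x - a|^2] gives
    [<h, x - m> >= |h| (|h| / 2 - |g|)] by Cauchy-Schwarz.  As |h| is at least
    8/10 of [D = |m - n|] and |g| at most D / 10, the second factor is at least
    3 D / 10. *)
Lemma nearest_center_dot (x a b m n : 'rV[R]_p) :
    norm2 (x - b) <= norm2 (x - a) ->
    norm2 (m - a) <= norm2 (m - n) / 10 ->
    norm2 (n - b) <= norm2 (m - n) / 10 ->
  norm2 (m - n) / 5 * norm2 (b - a) <= dot (b - a) (x - m).
Proof.
move=> xab ma nb.
have xb : x - b = (x - a) - (b - a) by rewrite opprB subrKA.
have xm : x - m = (x - a) - (m - a) by rewrite opprB subrKA.
have mn_le := ler_norm2_detour m n a b.
have hg := dot_le_norm2 (b - a) (m - a).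
have h_ge0 := norm2_ge0 (b - a).
move: xab; rewrite -ler_sqr ?nnegrE ?norm2_ge0// xb !sqr_norm2 xm.
move: {xb xm} (x - a) (b - a) (m - a) ma mn_le hg h_ge0 => u h g ma mn_le hg h_ge0.
rewrite !(dotDl, dotDr, dotNl, dotNr) (dotC u h) -(sqr_norm2 h).
set H := norm2 h in mn_le hg h_ge0 *; set D := norm2 (m - n) in ma nb mn_le *.
set G := norm2 g in ma mn_le hg.
have D_ge0 : 0 <= D := norm2_ge0 _.
have slack : 0 <= H * (H / 2 - G - D / 5) by rewrite mulr_ge0//; lra.
lra.
Qed.

Lemma center_dist_gt0 (a b m n : 'rV[R]_p) :
    0 < norm2 (m - n) ->
    norm2 (m - a) <= norm2 (m - n) / 10 ->
    norm2 (n - b) <= norm2 (m - n) / 10 ->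
  0 < norm2 (b - a).
Proof.
move=> mn0 ma nb.
by have := ler_norm2_detour m n a b; lra.
Qed.

End Euclidean.

(** * Tails of linear combinations of independent variables *)

Section Tails.
Context {d : measure_display} {T : measurableType d} {R : realType}.
Variable Q : probability T R.
Local Open Scope ereal_scope.

Lemma measurable_ge_set (f : T -> R) (t : R) :
  measurable_fun [set: T] f -> measurable [set w | (t <= f w)%R].
Proof.
move=> mf; rewrite -[X in measurable X]setTI.
by apply: measurable_fun_le => //; exact: measurable_cst.
Qed.

Definition centered_lincomb (X : nat -> {RV Q >-> R}) (s : seq nat) (a mu : nat -> R)
  : T -> R := fun w => (\sum_(i <- s) a i * (X i w - mu i))%R.

Lemma measurable_centered_lincomb X s a mu : measurable_fun [set: T] (centered_lincomb X s a mu).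
Proof.
apply: measurable_sum => i; apply: measurable_funM => //.
by apply: measurable_funB => //; exact: measurable_funP.
Qed.

Lemma chebyshev_lincomb (X : nat -> {RV Q >-> R}) (s : seq nat)
    (a : nat -> R) (s2 t : R) :
    mutually_independent Q (fun i => X i : T -> R) -> uniq s ->
    (forall i, (X i : T -> R) \in Lfun Q 2%:E) ->
    (forall i, 'V_Q[X i] <= s2%:E) -> (0 < t)%R ->
  Q [set w | (t <= \sum_(i <- s) a i * (X i w - fine 'E_Q[X i]))%R] <=
  (s2 * (\sum_(i <- s) a i ^+ 2) / t ^+ 2)%:E.
Proof.
move=> indX us X2 V2 t0.
pose mu i := fine 'E_Q[X i].
have Qfin : Q setT \is a fin_num by exact: fin_num_measure.
pose S : T -> R := fun w => (\sum_(i <- s) a i * X i w)%R.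
have S2 : S \in Lfun Q 2%:E by exact: Lfun2_lincomb.
have mS : measurable_fun [set: T] S.
  by apply: measurable_sum => i; apply: measurable_funM => //; exact: measurable_funP.
have ES : 'E_Q[S] = (\sum_(i <- s) a i * mu i)%:E.
  rewrite /S {us mS S2 S}; elim: s => [|j s IH].
    rewrite big_nil (_ : (fun w => _) = cst 0%R) ?expectation_cst//.
    by apply/funext => w; rewrite big_nil.
  rewrite (_ : (fun w => _) =
     ((a j \o* X j) \+ (fun w => \sum_(i <- s) a i * X i w))%R); last first.
    by apply/funext => w; rewrite big_cons /= mulrC.
  have Xj1 := Lfun_subset12 Qfin (X2 j).
  rewrite expectationD; last 2 first.
  - by apply: (Lfun_subset12 Qfin); rewrite Lfun_scale ?ler1n.
  - by apply: (Lfun_subset12 Qfin); exact: Lfun2_lincomb.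
  by rewrite IH expectationZl// big_cons EFinD EFinM fineK// expectation_fin_num.
pose SX : {mfun T >-> R} := HB.pack S (isMeasurableFun.Build _ _ _ _ S mS).
apply: (@le_trans _ _ (Q [set w | (t <= `|SX w - fine 'E_Q[SX]|)%R])).
  apply: le_measure; rewrite ?inE.
  - exact: measurable_ge_set (measurable_centered_lincomb X s a mu).
  - apply: measurable_ge_set; apply: measurableT_comp => //.
    exact: measurable_funB.
  - move=> w /=; rewrite -/(mu _) => tw.
    rewrite /= ES /=.
    apply: (le_trans _ (ler_norm _)); apply: le_trans tw _.
    by rewrite -sumrB; apply: ler_sum => i _; rewrite mulrBr.
apply: (le_trans (chebyshev _ t0)).
rewrite [X in _ * X](_ : _ = \sum_(i <- s) (a i ^+ 2)%:E * 'V_Q[X i]); last first.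
  exact: variance_lincomb_independent.
rewrite mulrC EFinM lee_pmul2l ?lte_fin ?invr_gt0 ?exprn_gt0//.
rewrite mulr_sumr -sumEFin; apply: lee_sum => i _.
by rewrite (mulrC s2) (EFinM _ s2); apply: lee_wpmul2l; rewrite ?lee_fin ?sqr_ge0.
Qed.

(** The exponential of a sum is a product of nonnegative functions of the single
    variables, so the product rule applies. *)
Lemma mmt_gen_lincomb_le (X : nat -> {RV Q >-> R}) (s : seq nat)
    (a mu : nat -> R) (v r : R) :
    mutually_independent Q (fun i => X i : T -> R) -> uniq s ->
    (forall i r, 'M_Q (X i \- cst (mu i))%R r <= (expR (2^-1 * r ^+ 2 * v))%:E) ->
  'M_Q (centered_lincomb X s a mu) r <=
  (expR (2^-1 * r ^+ 2 * v * \sum_(i <- s) a i ^+ 2))%:E.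
Proof.
move=> indX us sg.
have EE (Y : T -> R) : 'E_Q[Y] = \int[Q]_w (Y w)%:E by rewrite unlock.
have -> : 'M_Q (centered_lincomb X s a mu) r =
    \prod_(i <- s) 'M_Q (X i \- cst (mu i))%R (r * a i)%R.
  transitivity (\int[Q]_w (\prod_(i <- s) expR (r * a i * (X i w - mu i)))%:E).
    rewrite /mmt_gen_fun EE; apply: eq_integral => w _ /=.
    rewrite -expR_sum mulr_suml; congr (expR _)%:E.
    by apply: eq_bigr => i _; rewrite mulrC mulrA.
  rewrite (@ge0_integral_prod _ _ _ Q X s
      (fun i x => expR (r * a i * (x - mu i))) indX us)//; last first.
    move=> i; apply: measurableT_comp => //.
    by apply: measurable_funM => //; exact: measurable_funB.
  apply: eq_bigr => i _; rewrite /mmt_gen_fun EE.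
  by apply: eq_integral => w _ /=; rewrite mulrC.
rewrite mulr_sumr; elim: s {us} => [|i s IH].
  by rewrite !big_nil expR0.
rewrite !big_cons expRD EFinM; apply: lee_pmul => //.
- by apply: expectation_ge0 => w; exact: expR_ge0.
- by apply: prode_ge0 => j _; apply: expectation_ge0 => w; exact: expR_ge0.
- by rewrite (le_trans (sg _ _))// lee_fin ler_expR exprMn; lra.
Qed.

Lemma chernoff_lincomb (X : nat -> {RV Q >-> R}) (s : seq nat)
    (a mu : nat -> R) (v t : R) :
    mutually_independent Q (fun i => X i : T -> R) -> uniq s ->
    (forall i r, 'M_Q (X i \- cst (mu i))%R r <= (expR (2^-1 * r ^+ 2 * v))%:E) ->
    (0 < t)%R -> (0 < v)%R -> (0 < \sum_(i <- s) a i ^+ 2)%R ->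
  Q [set w | (t <= \sum_(i <- s) a i * (X i w - mu i))%R] <=
  (expR (- (t ^+ 2 / (2 * v * \sum_(i <- s) a i ^+ 2))))%:E.
Proof.
move=> indX us sg t0 v0 a0.
set A := (\sum_(i <- s) a i ^+ 2)%R.
(* minimizes the exponent r^2 v A / 2 - r t *)
pose r : R := (t / (v * A))%R.
have r0 : (0 < r)%R by rewrite divr_gt0// mulr_gt0.
pose SX : {mfun T >-> R} := HB.pack (centered_lincomb X s a mu)
  (isMeasurableFun.Build _ _ _ _ _ (measurable_centered_lincomb X s a mu)).
apply: (le_trans (chernoff SX t r0)).
have M := mmt_gen_lincomb_le X s a mu v r indX us sg.
apply: (@le_trans _ _ ((expR (2^-1 * r ^+ 2 * v * A))%:E * (expR (- (r * t)))%:E)).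
  by rewrite lee_wpmul2r// lee_fin expR_ge0.
rewrite -EFinM -expRD lee_fin ler_expR /r.
rewrite le_eqVlt; apply/orP; left; apply/eqP; field.
by rewrite !gt_eqF.
Qed.
End Tails.

(** * From conditional confusion probabilities to the error probability *)

Section Labels.
Context {d : measure_display} {T : measurableType d} {R : realType}.
Variables (P : probability T R) (K : nat) (Z : T -> 'I_K).
Hypothesis mZ : forall z, measurable (Z @^-1` [set z]).

Lemma probability_label_split (A : set T) (z : 'I_K) :
  (0 < P (Z @^-1` [set z]) ->
  P (A `&` Z @^-1` [set z]) = P (Z @^-1` [set z]) * given P mZ z A)%E.
Proof.
move=> Pz.
have Pfin : P (Z @^-1` [set z]) \is a fin_num by exact: fin_num_measure.
rewrite /given /cond_prob /= /mnormalize /= /mrestr setTI.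
rewrite (gt_eqF Pz) /= (_ : (_ == +oo)%E = false); last first.
  by rewrite lt_eqF// ltey_eq Pfin.
rewrite muleCA -[X in (_ = _ * (X * _))%E]fineK// -EFinM divff ?mule1//.
by rewrite gt_eqF// fine_gt0// Pz ltey_eq Pfin.
Qed.

End Labels.

Section Misclassification.
Context {d : measure_display} {T : measurableType d} {R : realType}.
Variables (P : probability T R) (K : nat) (Z Z' : T -> 'I_K).
Hypothesis mZ : forall z, measurable (Z @^-1` [set z]).
Hypothesis mZ' : forall z, measurable (Z' @^-1` [set z]).
Hypothesis Zpos : forall z, (0 < P (Z @^-1` [set z]))%E.

Lemma preimage_bigsetU (U : T -> 'I_K) (A : {pred 'I_K}) :
  U @^-1` [set z | A z] = \big[setU/set0]_(z < K | A z) (U @^-1` [set z]).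
Proof.
rewrite -bigcup_seq_cond; apply/seteqP; split => [w Aw|w [z /= /andP[_ Az] Uz]].
  by exists (U w) => //=; rewrite mem_index_enum.
by rewrite Uz.
Qed.

Lemma trivIset_preimage1 (U : T -> 'I_K) :
  trivIset setT (fun z => U @^-1` [set z]).
Proof. by move=> z v _ _ [w [/= <- <-]]. Qed.

Let wrong (z : 'I_K) : set T := Z' @^-1` [set v | v != z].

Lemma measurable_wrong z : measurable (wrong z).
Proof. by rewrite /wrong preimage_bigsetU; apply: bigsetU_measurable. Qed.

Lemma misclassifiedE : [set w | Z' w != Z w] =
  \big[setU/set0]_(z < K) (wrong z `&` Z @^-1` [set z]).
Proof.
rewrite -bigcup_seq; apply/seteqP; split => [w ZZ'|w [z _ [/= ? Zz]]].
  by exists (Z w) => //=; rewrite mem_index_enum.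
by rewrite Zz.
Qed.

Lemma measurable_misclassified : measurable [set w | Z' w != Z w].
Proof.
rewrite misclassifiedE; apply: bigsetU_measurable => z _.
by apply: measurableI => //; exact: measurable_wrong.
Qed.

(** The law of total probability over the true label, with a union bound over the
    wrong labels for each conditional probability. *)
Lemma misclassification_le (c : R) :
    (forall z v, v != z -> given P mZ z (Z' @^-1` [set v]) <= c%:E)%E ->
    0 <= c ->
  (P [set w | Z' w != Z w] <= (K%:R * c)%:E)%E.
Proof.
move=> cP c0.
have wrong_le z : (given P mZ z (wrong z) <= (K%:R * c)%:E)%E.
  rewrite /wrong preimage_bigsetU measure_bigsetU_ord//; last exact: trivIset_preimage1.
  apply: (@le_trans _ _ (\sum_(v < K | v != z) c%:E)%E).
    by apply: lee_sum => v; exact: cP.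
  apply: (@le_trans _ _ (\sum_(v < K) c%:E)%E).
    by rewrite big_mkcond /=; apply: lee_sum => v _; case: ifP => // _; rewrite lee_fin.
  by rewrite sumEFin sumr_const card_ord mulr_natl.
rewrite misclassifiedE measure_bigsetU_ord; last 2 first.
- by move=> z; apply: measurableI => //; exact: measurable_wrong.
- by move=> z v _ _ [w [[_ /= <-] [_ /= <-]]].
apply: (@le_trans _ _ (\sum_(z < K) P (Z @^-1` [set z]) * (K%:R * c)%:E)%E).
  apply: lee_sum => z _.
  rewrite [leLHS](probability_label_split _ _ _ mZ _ _ (Zpos z)).
  exact: lee_wpmul2l.
rewrite -ge0_sume_distrl; last by move=> z _; exact: measure_ge0.
rewrite -measure_bigsetU_ord//; last exact: trivIset_preimage1.
rewrite -(preimage_bigsetU Z xpredT) (_ : _ @^-1` _ = setT).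
  by rewrite [X in (X * _)%E]probability_setT mul1e.
by apply/seteqP; split.
Qed.

End Misclassification.

(** * Confusing two given labels *)

Section Coord.
Context {R : realType} {p : nat}.

(** The variables are indexed by all natural numbers and the vectors by ['I_p];
    the junk value 0 beyond p is never summed. *)
Definition coord_nat (h : 'rV[R]_p) (i : nat) : R :=
  oapp (fun j : 'I_p => h 0 j) 0 (insub i).

Lemma sum_coord_nat (h : 'rV[R]_p) (F : R -> nat -> R) :
  \sum_(0 <= i < p) F (coord_nat h i) i = \sum_(i < p) F (h 0 i) i.
Proof. by rewrite big_mkord; apply: eq_bigr => i _; rewrite /coord_nat valK. Qed.

Lemma sum_sqr_coord_nat (h : 'rV[R]_p) :
  \sum_(0 <= i < p) coord_nat h i ^+ 2 = norm2 h ^+ 2.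
Proof.
rewrite sqr_norm2 (sum_coord_nat h (fun c _ => c ^+ 2)).
by apply: eq_bigr => i _; rewrite expr2.
Qed.
End Coord.

Section Pairs.
Context {d : measure_display} {T : measurableType d} {R : realType}.
Variables (P : probability T R) (K : nat) (Z : T -> 'I_K).
Hypothesis mZ : forall z, measurable (Z @^-1` [set z]).
Variables (X : nat -> {RV P >-> R}) (p : nat) (muc : 'I_K -> 'rV[R]_p).
Variable Z' : T -> 'I_K.
Hypothesis hZ' : nearest_center X muc Z'.
Hypothesis hdist : forall z v, v != z -> mean_dist mZ X p z v != 0.
Hypothesis hrel : forall z v, v != z -> relative_error mZ X muc z v <= 10^-1.

Lemma mean_distC z v : mean_dist mZ X p z v = mean_dist mZ X p v z.
Proof. by rewrite /mean_dist -norm2N opprB. Qed.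

Lemma mean_dist_gt0 z v : v != z -> 0 < mean_dist mZ X p z v.
Proof. by move=> vz; rewrite lt_def hdist//= norm2_ge0. Qed.

Lemma center_error_le z v : v != z ->
  norm2 (mean_vec mZ X p z - muc z) <= mean_dist mZ X p z v / 10.
Proof.
by move=> vz; have := hrel _ _ vz; rewrite /relative_error ler_pdivrMr ?mean_dist_gt0// mulrC.
Qed.

Lemma center_gap_gt0 z v : v != z -> 0 < norm2 (muc v - muc z).
Proof.
move=> vz; apply: (@center_dist_gt0 _ _ (muc z) (muc v) (mean_vec mZ X p z) (mean_vec mZ X p v)).
- exact: mean_dist_gt0.
- exact: center_error_le.
- by rewrite -/(mean_dist _ _ _ _ _) mean_distC center_error_le// eq_sym.
Qed.

Lemma confusion_event_sub z v : v != z ->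
  Z' @^-1` [set v] `<=`
  [set w | mean_dist mZ X p z v / 5 * norm2 (muc v - muc z) <=
     \sum_(0 <= i < p) coord_nat (muc v - muc z) i * (X i w - cond_mean mZ X i z)].
Proof.
move=> vz w /= Zw.
rewrite (sum_coord_nat _ (fun c i => c * (X i w - cond_mean mZ X i z))).
have -> : \sum_(i < p) (muc v - muc z) 0 i * (X i w - cond_mean mZ X i z) =
    dot (muc v - muc z) (obs X p w - mean_vec mZ X p z).
  by apply: eq_bigr => i _; rewrite !mxE.
apply: nearest_center_dot.
- by rewrite -{1}Zw; exact: (nearest_center_argmin hZ').
- exact: center_error_le.
- by rewrite -/(mean_dist _ _ _ _ _) mean_distC center_error_le// eq_sym.
Qed.

Lemma confusion_le_tail z v : v != z ->
  (given P mZ z (Z' @^-1` [set v]) <= given P mZ z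
  [set w | mean_dist mZ X p z v / 5 * norm2 (muc v - muc z) <=
     \sum_(0 <= i < p) coord_nat (muc v - muc z) i * (X i w - cond_mean mZ X i z)]%R)%E.
Proof.
move=> vz; apply: le_measure; rewrite ?inE; last exact: confusion_event_sub.
  exact: (nearest_center_measurable hZ').
by apply: measurable_ge_set; exact: measurable_centered_lincomb.
Qed.

Lemma chebyshev_confusion s2 z v : v != z ->
    mutually_independent (given P mZ z) (fun i => X i : T -> R) ->
    (forall i, (X i : T -> R) \in Lfun (given P mZ z) 2%:E) ->
    (forall i, cond_var mZ X i z <= s2%:E)%E ->
  (given P mZ z (Z' @^-1` [set v]) <= (25 * s2 / mean_dist mZ X p z v ^+ 2)%:E)%E.
Proof.
move=> vz indX X2 V2; apply: (le_trans (confusion_le_tail _ _ vz)).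
have D0 := mean_dist_gt0 _ _ vz; have H0 := center_gap_gt0 _ _ vz.
apply: (le_trans (chebyshev_lincomb (given P mZ z) X (index_iota 0 p)
  (coord_nat (muc v - muc z)) s2 _ indX (iota_uniq _ _) X2 V2 _)).
  by rewrite mulr_gt0// divr_gt0.
rewrite sum_sqr_coord_nat lee_fin le_eqVlt; apply/orP; left; apply/eqP; field.
by rewrite !gt_eqF.
Qed.

Lemma chernoff_confusion vmax z v : v != z -> 0 < vmax ->
    mutually_independent (given P mZ z) (fun i => X i : T -> R) ->
    cond_sub_gaussian mZ X vmax ->
  (given P mZ z (Z' @^-1` [set v]) <=
     (expR (- (mean_dist mZ X p z v ^+ 2 / (50 * vmax))))%:E)%E.
Proof.
move=> vz v0 indX sg; apply: (le_trans (confusion_le_tail _ _ vz)).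
have D0 := mean_dist_gt0 _ _ vz; have H0 := center_gap_gt0 _ _ vz.
apply: (le_trans (chernoff_lincomb (given P mZ z) X (index_iota 0 p)
  (coord_nat (muc v - muc z)) (fun i => cond_mean mZ X i z) vmax _
  indX (iota_uniq _ _) _ _ v0 _)).
(* the hypothesis bounds ln M; as M >= 0, exponentiating recovers M *)
- move=> i r.
  have M0 : (0 <= 'M_(given P mZ z) (X i \- cst (cond_mean mZ X i z))%R r)%E.
    by apply: expectation_ge0 => w; exact: expR_ge0.
  move: (M0); rewrite -lneK_eq => /eqP <-.
  by rewrite -[leRHS]/(expeR (2^-1 * r ^+ 2 * vmax)%:E) lee_expeR; exact: sg.
- by rewrite mulr_gt0// divr_gt0.
- by rewrite sum_sqr_coord_nat exprn_gt0.
rewrite sum_sqr_coord_nat lee_fin ler_expR le_eqVlt; apply/orP; left; apply/eqP; field.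
by rewrite !gt_eqF.
Qed.

Lemma sep_le z v : v != z -> sep mZ X p <= mean_dist mZ X p z v ^+ 2.
Proof.
move=> vz; apply: ge_inf.
  by exists 0 => _ [zv _ <-]; exact: sqr_ge0.
by exists (z, v) => //=; rewrite eq_sym.
Qed.

(** There are finitely many pairs of labels, so the infimum is attained.  Were it
    0, the first bound would read 0 by the convention for division. *)
Lemma sep_gt0 : (2 <= K)%N -> 0 < sep mZ X p.
Proof.
move=> K2; pose dist2 (zv : 'I_K * 'I_K) := mean_dist mZ X p zv.1 zv.2 ^+ 2.
pose zv0 : 'I_K * 'I_K := (Ordinal (ltnW K2), Ordinal K2).
have zv0P : zv0.1 != zv0.2 by [].
have [zv zvP zvmin] := @arg_minP _ _ _ zv0 [pred zv | zv.1 != zv.2] dist2 zv0P.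
apply: (@lt_le_trans _ _ (dist2 zv)).
  by rewrite exprn_gt0// mean_dist_gt0// eq_sym.
apply: lb_le_inf; first by exists (dist2 zv0), zv0.
by move=> _ [zv' ? <-]; exact: zvmin.
Qed.

End Pairs.

Theorem proposition4 (d : measure_display) (T : measurableType d)
  (R : realType) (P : probability T R)
  (K : nat) (hK : (2 <= K)%N)
  (Z : T -> 'I_K) (mZ : forall z, measurable (Z @^-1` [set z]))
  (X : nat -> {RV P >-> R}) (sigma2_min sigma2_max : R)
  (hmix : mixture_model mZ X sigma2_min sigma2_max)
  (p : nat) (muc : 'I_K -> 'rV[R]_p)
  (Zhat : T -> 'I_K) (hZhat : nearest_center X muc Zhat)
  (hdist : forall z v, v != z -> mean_dist mZ X p z v != 0)
  (hrel : forall z v, v != z -> relative_error mZ X muc z v <= 10^-1) :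
  (P [set w | Zhat w != Z w]
     <= (25 * K%:R * sigma2_max / sep mZ X p)%:E)%E
  /\ (forall vmax : R, cond_sub_gaussian mZ X vmax ->
      (P [set w | Zhat w != Z w]
         <= (K%:R * expR (- (sep mZ X p / (50 * vmax))))%:E)%E).
Proof.
case: hmix => indX X2 _ /andP[smin0 smin_max] maxV Zpos.
have smax0 : 0 <= sigma2_max by rewrite (le_trans (ltW smin0)).
have sep0 : 0 < sep mZ X p by exact: sep_gt0.
have mZhat := nearest_center_measurable hZhat.
split.
  rewrite (_ : 25 * K%:R * _ / _ = K%:R * (25 * sigma2_max / sep mZ X p)); last first.
    by rewrite -!mulrA mulrCA.
  apply: (misclassification_le P K Z Zhat mZ) => //; last first.
    by rewrite divr_ge0 ?mulr_ge0// ltW.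
  move=> z v vz.
  have V2 i : (cond_var mZ X i z <= sigma2_max%:E)%E.
    have /andP[_] := maxV i; apply: le_trans.
    exact: (le_bigmax _ (fun z => cond_var mZ X i z)).
  apply: (le_trans (chebyshev_confusion P K Z mZ X p muc Zhat hZhat hdist hrel
    _ _ _ vz (indX z) (X2 z) V2)) => //.
  rewrite lee_fin ler_wpM2l ?mulr_ge0// lef_pV2 ?posrE ?sep_le//.
  by rewrite exprn_gt0// mean_dist_gt0.
move=> vmax sg.
have [v0|v0] := ltP 0 vmax.
  apply: (misclassification_le P K Z Zhat mZ) => //.
  move=> z v vz.
  apply: (le_trans (chernoff_confusion P K Z mZ X p muc Zhat hZhat hdist hrel
    _ _ _ vz v0 (indX z) sg)) => //.
  rewrite lee_fin ler_expR lerN2 ler_pM2r ?invr_gt0 ?mulr_gt0//.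
  exact: sep_le.
(* without vmax > 0 the claimed bound is at least 1 *)
apply: (@le_trans _ _ 1%E).
  by apply: probability_le1; exact: (measurable_misclassified K Z Zhat mZ).
rewrite lee_fin -[leLHS]mul1r ler_pM//; first by rewrite ler1n (ltn_trans _ hK).
rewrite -expR0 ler_expR oppr_ge0; apply: mulr_ge0_le0; first exact: ltW.
by rewrite invr_le0 pmulr_rle0.
Qed.
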